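(* There exists an absolute constant $c>0$ such that for all sufficiently large $N$ and all integers $k$ with $1\le k\le N$: every (possibly randomized) protocol in the line model below for which player $P_{k+1}$ outputs $\mathbf{A}_k\mathbf{A}_{k-1}\cdots\mathbf{A}_1\mathbf{x}$ (over $\mathbb{F}_2$) correctly with probability at least $1/2$, when $\mathbf{x}\in\mathbb{F}_2^N$ and $\mathbf{A}_1,\dots,\mathbf{A}_k\in\mathbb{F}_2^{N\times N}$ are uniformly distributed and mutually independent, uses at least $ckN$ rounds.
   Context: Line model: there are $k+2$ players $P_0,\dots,P_{k+1}$ with communication links exactly $\{P_{i-1},P_i\}$ for $i\in[k+1]$. $P_0$ holds $\mathbf{x}$, $P_i$ holds $\mathbf{A}_i$ for $i\in[k]$, and $P_{k+1}$ has no input and must output the answer. Communication is synchronous in rounds; in each round one bit is sent over each link (direction determined by the protocol from previous communication), and each bit a player sends depends only on its input, its randomness and the bits it has received in earlier rounds. *)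

(* Defs.v *)
From HB Require Import structures.
From mathcomp Require Import all_boot all_order all_algebra.
Set Implicit Arguments. Unset Strict Implicit. Unset Printing Implicit Defensive.
Import GRing.Theory Num.Theory.

(* Players P_0 .. P_{k+1} are indexed by 'I_k.+2; links by 'I_k.+1, link j
   joining P_j (left endpoint) and P_{j+1} (right endpoint).
   Every player receives a local input of the uniform type
   'cV_N * 'M_N : P_0 gets (x, 0), P_i (1<=i<=k) gets (0, A_i), P_{k+1} gets (0,0).
   Each player's private randomness is a bit string of length m. *)
Record protocol (N k m : nat) := Protocol {
  (* direction of the bit on link j in the next round, as a function of the
     bits previously communicated on that link; true = left-to-right *)
  dir : 'I_k.+1 -> seq bool -> bool;
  (* bit sent by player p (on its right link if the bool is true, on its left
     link otherwise), given its local input, its randomness, and the bit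
     histories of its left and right links *)
  msg : 'I_k.+2 -> 'cV['F_2]_N * 'M['F_2]_N -> m.-tuple bool -> bool ->
        seq bool -> seq bool -> bool;
  (* output of P_{k+1}: from its randomness and the history of its only link *)
  out : m.-tuple bool -> seq bool -> 'cV['F_2]_N }.

Section Exec.
Variables (N k m : nat) (P : protocol N k m).

Definition getA (As : {ffun 'I_k -> 'M['F_2]_N}) (i : nat) : 'M['F_2]_N :=
  oapp As 0%R (insub i).

Definition local_input (x : 'cV['F_2]_N) (As : {ffun 'I_k -> 'M['F_2]_N})
    (p : nat) : 'cV['F_2]_N * 'M['F_2]_N :=
  if p == 0%N then (x, 0%R)
  else if (p <= k)%N then (0%R, getA As p.-1) else (0%R, 0%R).

Fixpoint transcripts (x : 'cV['F_2]_N) (As : {ffun 'I_k -> 'M['F_2]_N})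
    (r : {ffun 'I_k.+2 -> m.-tuple bool}) (t : nat) : nat -> seq bool :=
  match t with
  | 0 => fun _ => [::]
  | t'.+1 =>
    let h := transcripts x As r t' in
    let left p := if p is p'.+1 then h p' else [::] in
    fun j =>
      if (j < k.+1)%N then
        rcons (h j)
          (if dir P (inord j) (h j)
           then msg P (inord j) (local_input x As j) (r (inord j)) true
                    (left j) (h j)
           else msg P (inord j.+1) (local_input x As j.+1) (r (inord j.+1))
                    false (h j) (h j.+1))
      else [::]
  end.

Definition chain_product (x : 'cV['F_2]_N) (As : {ffun 'I_k -> 'M['F_2]_N}) :=
  foldl (fun v j => (getA As j *m v)%R) x (iota 0 k).

Definition correct_run (T : nat) (x : 'cV['F_2]_N) (As : {ffun 'I_k -> 'M['F_2]_N})
    (r : {ffun 'I_k.+2 -> m.-tuple bool}) : bool :=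
  out P (r ord_max) (transcripts x As r T k) == chain_product x As.

Definition succeeds_half (T : nat) : Prop :=
  (#|{: 'cV['F_2]_N * {ffun 'I_k -> 'M['F_2]_N} * {ffun 'I_k.+2 -> m.-tuple bool}}|
   <= 2 * #|[pred w : 'cV['F_2]_N * {ffun 'I_k -> 'M['F_2]_N}
                        * {ffun 'I_k.+2 -> m.-tuple bool}
             | correct_run T w.1.1 w.1.2 w.2]|)%N.

End Exec.

(* Main.v *)
Require Import Defs.
From HB Require Import structures.
From mathcomp Require Import all_boot all_order all_algebra.
From mathcomp Require Import zify.
Import GRing.Theory Num.Theory.

(* Let [e] be about [N / 32] and write [y_j = A_j ... A_1 x]. For each [j], after
   [j * e] rounds, [y_j] retains min-entropy at least about [5 e] given the
   transcript of link [j], except on a [3 j 2^-e] fraction of the inputs; hence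
   the last player cannot guess [y_k] after [k * e] rounds.

   For the inductive step, fix the transcripts of links [j] and [j + 1] at time
   [j * e] and the matrices to the right of [A_{j+1}]. The left input (hence
   [y_j]) and [A_{j+1}] are then independent, and [A_{j+1}] ranges over a set
   [S]; on average [S] has density at least [2 ^ (- 2 j e)], a small power of
   [2 ^ (- N^2)]. If [y_j] were often such that [A_{j+1} y_j] hits a value that
   is heavy over [S], many matrices would send many independent vectors to heavy
   values, and there are too few such matrices. Apart from this event,
   [y_{j+1}] has min-entropy at least [7 e] given the transcript of link [j + 1]
   at time [j * e], and the next [e] rounds reveal only [e] further bits. *)

Set Implicit Arguments. Unset Strict Implicit. Unset Printing Implicit Defensive.
Local Open Scope ring_scope.
Local Open Scope nat_scope.

Lemma card_F2_mx m n : #|{: 'M['F_2]_(m, n)}| = 2 ^ (m * n).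
Proof. by rewrite card_mx card_Fp. Qed.

(** * Counting matrices that often send a random vector to a heavy value *)

Section BadMatrices.
Variable n : nat.
Implicit Types (A D V : 'M['F_2]_n) (y z : 'cV['F_2]_n).

Lemma card_rowspace V : #|[pred y : 'cV['F_2]_n | (y^T <= V)%MS]| <= 2 ^ \rank V.
Proof.
have <- : #|{: 'rV['F_2]_(\rank V)}| = 2 ^ \rank V by rewrite card_F2_mx mul1n.
pose f (c : 'rV['F_2]_(\rank V)) := ((c *m row_base V)^T)%R.
apply: leq_trans (leq_imset_card f predT).
apply/subset_leq_card/subsetP => y; rewrite inE => yV.
have /submxP[c yE] : (y^T <= row_base V)%MS by rewrite eq_row_base.
by apply/imsetP; exists c; rewrite // /f -yE trmxK.
Qed.

(** Equality of [A] and [A0] on all vectors whose transpose lies in the row space of [V]. *)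
Definition agree V A0 A := (V *m (A - A0)^T == 0)%R.

(** Some row [c] is orthogonal to [V] and has [c y = 1]. Adding [t c] to [A], for the [2^n] columns
    [t], preserves agreement and shifts [A y] by [t], so the translates of the fiber are
    disjoint. *)
Lemma card_agree_fiber V A0 y z : ~~ (y^T <= V)%MS ->
  #|[pred A | agree V A0 A && (A *m y == z)%R]| * 2 ^ n
    <= #|[pred A | agree V A0 A]|.
Proof.
move=> yV.
have [c cV cy] : exists2 c : 'rV['F_2]_n, (V *m c^T = 0)%R & (c *m y = 1%:M)%R.
  have [i ni] : exists i, (y^T *m cokermx V)%R ord0 i != 0%R.
    apply/existsP; apply: contraNT yV; rewrite negb_exists => /forallP h.
    rewrite submxE; apply/eqP/rowP => j; rewrite [RHS]mxE.
    by apply/eqP; have := h j; rewrite negbK.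
  set s := (_ *m _)%R _ _ in ni.
  exists (s^-1 *: (col i (cokermx V))^T)%R.
    by rewrite linearZ /= trmxK -scalemxAr colE mulmxA mulmx_coker mul0mx scaler0.
  rewrite -scalemxAl -[y]trmxK -trmx_mul colE mulmxA -colE.
  have -> : (col i (y^T *m cokermx V) = s%:M)%R.
    by apply/matrixP => p p'; rewrite !ord1 [LHS]mxE [RHS]mxE eqxx.
  by rewrite tr_scalar_mx scale_scalar_mx mulVf.
rewrite -[2 ^ n](_ : #|{: 'cV['F_2]_n}| = _); last by rewrite card_F2_mx muln1.
rewrite -cardX.
pose f (p : 'M['F_2]_n * 'cV['F_2]_n) := (p.1 + p.2 *m c)%R.
rewrite -(card_in_image (f := f)).
  apply/subset_leq_card/subsetP => B /imageP[[A t]]; rewrite !inE /= => /andP[/andP[h _] _] ->.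
  rewrite /agree /f /= addrAC linearD /= mulmxDr (eqP h) add0r trmx_mul mulmxA cV.
  by rewrite mul0mx.
move=> [A t] [B s]; rewrite !inE /f /= => /andP[/andP[_ /eqP hA] _] /andP[/andP[_ /eqP hB] _] E.
have ts : t = s.
  have := congr1 (fun D => (D *m y)%R) E.
  rewrite /= !mulmxDl -!mulmxA cy !mulmx1 hA hB; exact: addrI.
by move: E; rewrite ts => /addIr ->.
Qed.

Variables (w : 'cV['F_2]_n -> nat) (M : nat) (Hv : rel 'cV['F_2]_n).
Variables (a b h : nat).

(* The [w]-weight of the [m]-tuples of vectors, independent modulo the row space
   of [V], that [A] maps to [Hv]-related vectors. *)
Fixpoint free_weight A m V : nat :=
  if m is m'.+1 then
    \sum_(y | Hv y (A *m y)%R && ~~ (y^T <= V)%MS)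
       w y * free_weight A m' (V + y^T)%MS
  else 1.

Definition bad_mx A := M < 2 ^ b * \sum_(y | Hv y (A *m y)%R) w y.

Hypothesis w_small : forall y, w y * 2 ^ a <= M.
Hypothesis w_sum : \sum_y w y <= M.
Hypothesis Hv_few : forall y, #|[pred z | Hv y z]| <= 2 ^ h.

(** Vectors are chosen one by one. The row space of [V] has at most [2^(\rank V)] vectors of weight
    at most [2^-a M]; as [q + b < a], avoiding it loses less than half of the bad weight, and
    [2^-(b+1) M] is left for each choice. *)
Lemma free_weight_ge A q V m : bad_mx A -> q + b < a -> \rank V + m <= q ->
  M ^ m <= free_weight A m V * 2 ^ (b.+1 * m).
Proof.
move=> badA qa; elim: m V => [|m IH] V rV /=; first by rewrite muln0.
have key : M <= (\sum_(y | Hv y (A *m y)%R && ~~ (y^T <= V)%MS) w y) * 2 ^ b.+1.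
  move: badA; rewrite /bad_mx (bigID (fun y => (y^T <= V)%MS)) /=.
  set s1 := \sum_(_ | _ && (_ <= _)%MS) _; set s2 := \sum_(_ | _) _ => badA.
  have hs1 : s1 * 2 ^ b.+1 <= M.
    have s1le : s1 * 2 ^ a <= M * 2 ^ \rank V.
      rewrite big_distrl /=.
      apply: (@leq_trans (\sum_(y | (y^T <= V)%MS) M)).
        rewrite [X in _ <= X](bigID (fun y => Hv y (A *m y)%R)) /=.
        rewrite (eq_bigl (fun y => (y^T <= V)%MS && Hv y (A *m y)%R)); last by move=> y; rewrite andbC.
        by apply: leq_trans (leq_addr _ _); apply: leq_sum => y _.
      rewrite sum_nat_const mulnC leq_mul2l; apply/orP; right; exact: card_rowspace.
    have : 2 ^ (\rank V + b.+1) <= 2 ^ a by rewrite leq_exp2l //; lia.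
    rewrite expnD => hle.
    rewrite -(@leq_pmul2r (2 ^ \rank V)) ?expn_gt0 //.
    apply: leq_trans s1le; rewrite -mulnA leq_mul2l [X in X <= _]mulnC hle orbT //.
  move: badA hs1; rewrite expnS; lia.
rewrite expnS mulnS expnD.
apply: leq_trans (leq_mul key (leqnn _)) _.
rewrite mulnAC [2 ^ b.+1 * _]mulnC mulnA.
rewrite leq_mul2r; apply/orP; right.
rewrite !big_distrl /=; apply: leq_sum => y /andP[_ yV].
rewrite -mulnA leq_mul2l; apply/orP; right; apply: IH.
apply: leq_trans rV; rewrite addnS -addSn leq_add2r.
apply: leq_trans (mxrank_adds_leqif V (y^T)%R).1 _.
by rewrite -[leqRHS]addn1 leq_add2l rank_leq_row.
Qed.

Lemma agree_add V A0 A y : agree V A0 A && (A *m y == A0 *m y)%R = agree (V + y^T)%MS A0 A.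
Proof.
rewrite /agree -!sub_kermx; apply/idP/idP.
  case/andP=> h1 /eqP h2; rewrite addsmx_sub h1 sub_kermx -trmx_mul mulmxBl h2 subrr.
  by rewrite trmx0 eqxx.
rewrite addsmx_sub => /andP[-> /=].
rewrite sub_kermx -trmx_mul mulmxBl => /eqP/(congr1 trmx).
by rewrite trmxK trmx0 => /eqP; rewrite subr_eq0.
Qed.

(** For random [A] agreeing with [A0] on [V] and a fresh [y], [A y] meets the at most [2^h] related
    values with probability at most [2^(h-n)]; fixing it enlarges [V], and the weights of [y] add up
    to at most [M]. *)
Lemma sum_free_weight_le m V A0 :
  (\sum_(A | agree V A0 A) free_weight A m V) * 2 ^ (n * m)
    <= M ^ m * 2 ^ (h * m) * #|[pred A | agree V A0 A]|.
Proof.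
elim: m V A0 => [|m IH] V A0 /=.
  by rewrite !muln0 !muln1 mul1n sum1_card.
set C := #|_|.
rewrite (exchange_big_dep (fun y => ~~ (y^T <= V)%MS)) /=; last by move=> A y _ /andP[].
have step y : ~~ (y^T <= V)%MS ->
   (\sum_(A | agree V A0 A && (Hv y (A *m y)%R && ~~ (y^T <= V)%MS))
      w y * free_weight A m (V + y^T)%MS) * 2 ^ (n * m.+1)
   <= w y * (M ^ m * 2 ^ (h * m.+1) * C).
  move=> yV; rewrite -big_distrr /= -mulnA leq_mul2l; apply/orP; right.
  rewrite (partition_big (fun A => (A *m y)%R) (Hv y)) /=; last by move=> A /and3P[].
  rewrite mulnSr expnD.
  have zb z : Hv y z ->
    (\sum_(A | agree V A0 A && (Hv y (A *m y)%R && ~~ (y^T <= V)%MS) && (A *m y == z)%R)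
      free_weight A m (V + y^T)%MS) * (2 ^ (n * m) * 2 ^ n) <= M ^ m * 2 ^ (h * m) * C.
    move=> Hz.
    rewrite (eq_bigl (fun A => agree V A0 A && (A *m y == z)%R)); last first.
      move=> A; rewrite yV andbT; case: (_ =P z) => [->|]; last by rewrite !andbF.
      by rewrite Hz !andbT.
    (* Any matrix of the fiber can replace [A0] as base point for [V + y^T]. *)
    case: (pickP (fun A => agree V A0 A && (A *m y == z)%R)) => [A1|none]; last first.
      by rewrite big_pred0.
    move=> /andP[h1 /eqP h2].
    have E A : agree V A0 A && (A *m y == z)%R = agree (V + y^T)%MS A1 A.
      rewrite -agree_add h2; congr andb; rewrite /agree.
      have -> : (A - A0 = A - A1 + (A1 - A0))%R by rewrite addrA subrK.
      by rewrite linearD /= mulmxDr (eqP h1) addr0.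
    rewrite (eq_bigl _ _ E) mulnA.
    apply: leq_trans (leq_mul (IH _ _) (leqnn _)) _.
    rewrite -mulnA leq_mul2l; apply/orP; right.
    apply: leq_trans (card_agree_fiber A0 z yV).
    rewrite leq_mul2r; apply/orP; right; apply/eq_leq/eq_card => A.
    by rewrite !inE E.
  rewrite big_distrl /=.
  apply: leq_trans (leq_sum _ zb) _.
  rewrite sum_nat_const mulnC mulnSr expnD.
  rewrite -[X in X <= _]mulnA [C * _]mulnC !mulnA leq_mul2r; apply/orP; right.
  by rewrite leq_mul2l Hv_few orbT.
rewrite big_distrl /=; apply: leq_trans (leq_sum _ step) _.
rewrite -big_distrl /= expnS -!mulnA leq_mul2r; apply/orP; right.
apply: leq_trans w_sum; rewrite [X in _ <= X](bigID (fun y => (y^T <= V)%MS)) /=.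
exact: leq_addl.
Qed.

(* A bad matrix carries much weight on q-tuples of independent vectors; for each
   such tuple the images are restricted to few values, which is a strong
   constraint on the matrix. *)
Lemma card_bad_mx q : 0 < M -> q + b < a ->
  #|[pred A | bad_mx A]| * 2 ^ (n * q) <= 2 ^ (n * n) * 2 ^ ((h + b.+1) * q).
Proof.
move=> M0 qa.
have low : #|[pred A | bad_mx A]| * M ^ q
    <= (\sum_(A | agree 0%R 0%R A) free_weight A q 0%R) * 2 ^ (b.+1 * q).
  rewrite -sum_nat_const big_distrl /=.
  rewrite [X in _ <= X](bigID bad_mx) /=.
  apply: leq_trans (leq_addr _ _).
  rewrite [X in _ <= X](eq_bigl bad_mx); last by move=> A; rewrite /agree mul0mx eqxx.
  by apply: leq_sum => A; rewrite inE => bA; apply: (@free_weight_ge _ q) => //; rewrite mxrank0.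
have up := sum_free_weight_le q 0%R 0%R.
have cle : #|[pred A | agree 0%R 0%R A]| <= 2 ^ (n * n).
  by rewrite -card_F2_mx; apply: max_card.
rewrite -(@leq_pmul2r (M ^ q)) ?expn_gt0 ?M0 //.
set S := \sum_(_ | _) _ in low up.
apply: (@leq_trans (S * 2 ^ (n * q) * 2 ^ (b.+1 * q))).
  by rewrite mulnAC [X in _ <= X]mulnAC leq_mul2r low orbT.
apply: leq_trans (leq_mul up (leqnn _)) _.
rewrite mulnDl expnD; move: cle.
set c := #|_|; set x := M ^ q; set p := 2 ^ (h * q); set r := 2 ^ (b.+1 * q) => cle.
have -> : x * p * c * r = c * (p * r * x) by lia.
by rewrite -[X in _ <= X]mulnA leq_mul2r cle orbT.
Qed.

End BadMatrices.

(** * Locality of transcripts: cut and paste at a link *)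

Section Transcripts.
Variables (N k m : nat) (P : protocol N k m) (r : {ffun 'I_k.+2 -> m.-tuple bool}).
Local Notation input := (nat -> 'cV['F_2]_N * 'M['F_2]_N).

Fixpoint run (inp : input) (t : nat) : nat -> seq bool :=
  match t with
  | 0 => fun _ => [::]
  | t'.+1 =>
    let h := run inp t' in
    let left p := if p is p'.+1 then h p' else [::] in
    fun j =>
      if (j < k.+1)%N then
        rcons (h j)
          (if dir P (inord j) (h j)
           then msg P (inord j) (inp j) (r (inord j)) true (left j) (h j)
           else msg P (inord j.+1) (inp j.+1) (r (inord j.+1))
                    false (h j) (h j.+1))
      else [::]
  end.

Lemma transcripts_run x As t : transcripts P x As r t = run (local_input x As) t.
Proof. by elim: t => //= t ->. Qed.

Lemma size_run inp t j : j <= k -> size (run inp t j) = t.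
Proof. by move=> jk; elim: t => [|t IH] //=; rewrite ltnS jk size_rcons IH. Qed.

Lemma take_run inp s t j : j <= k -> take s (run inp (s + t) j) = run inp s j.
Proof.
move=> jk; elim: t => [|t IH]; first by rewrite addn0 take_oversize // size_run.
by rewrite addnS /= ltnS jk -cats1 takel_cat ?IH // size_run ?leq_addr.
Qed.

(** The two sides of link [j] learn about each other only through it. By induction on rounds, its
    history is common to all three runs, and each other bit is computed within one side. *)
Lemma run_mix (inp inp1 inp2 : input) j t :
  (forall p, p <= j -> inp p = inp1 p) -> (forall p, j < p -> inp p = inp2 p) ->
  run inp1 t j = run inp2 t j ->
  forall i, (i <= j -> run inp t i = run inp1 t i) /\
            (j <= i -> run inp t i = run inp2 t i).
Proof.
move=> H1 H2; elim: t => [|t IH] //.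
have [jk|kj] := ltnP j k.+1; last first.
  move=> _ i; split=> [ij|ji] /=; last by rewrite ltnNge (leq_trans kj ji).
  case: (ltnP i k.+1) => // ik.
  have E : run inp1 t j = run inp2 t j by case: (t) => //= t'; rewrite ltnNge kj.
  have ij' : i < j by apply: leq_trans kj.
  rewrite H1 // (H1 i.+1) // (IH E i).1 // (IH E i.+1).1 //.
  by case: i ij ik ij' => // i ij ik ij'; rewrite (IH E i).1 // ltnW.
rewrite /= jk => /rcons_inj[E Eb].
have eqL i : i <= j -> run inp t i = run inp1 t i by move=> ?; apply: (IH E i).1.
have eqR i : j <= i -> run inp t i = run inp2 t i by move=> ?; apply: (IH E i).2.
(* If [P_{j+1}] sends, the mixed run produces the bit of [inp2], which equals that of [inp1] by
   [Eb]. *)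
have at_j : rcons (run inp t j)
      (if dir P (inord j) (run inp t j)
       then msg P (inord j) (inp j) (r (inord j)) true
           (if j is p'.+1 then run inp t p' else [::]) (run inp t j)
       else msg P (inord j.+1) (inp j.+1) (r (inord j.+1)) false
           (run inp t j) (run inp t j.+1))
   = rcons (run inp1 t j) 
      (if dir P (inord j) (run inp1 t j)
       then msg P (inord j) (inp1 j) (r (inord j)) true
           (if j is p'.+1 then run inp1 t p' else [::]) (run inp1 t j)
       else msg P (inord j.+1) (inp1 j.+1) (r (inord j.+1)) false
           (run inp1 t j) (run inp1 t j.+1)).
  rewrite (eqL j) //; congr rcons; move: Eb; rewrite -E.
  case: ifP => _ Eb.
    rewrite H1 //; congr msg.
    by case: (j) eqL => // p eqL; apply: eqL.
  by rewrite H2 // eqR // Eb.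
move=> i; split.
  rewrite leq_eqVlt => /orP[/eqP ->|ij]; first by rewrite jk.
  rewrite H1 ?(ltnW ij) // (H1 i.+1) // (eqL i) ?(ltnW ij) // (eqL i.+1) //.
  by case: i ij => // i ij; rewrite (eqL i) // ltnW // ltnW.
rewrite leq_eqVlt => /orP[/eqP <-|ji]; first by rewrite jk at_j Eb E.
rewrite H2 // (H2 i.+1) ?(ltnW ji) // ?(leq_trans ji) // (eqR i) ?(ltnW ji) // (eqR i.+1) ?(leq_trans (ltnW ji)) //.
by case: i ji => // i ji; rewrite (eqR i).
Qed.

End Transcripts.

(** * Heavy values, and one step of the induction *)

Lemma card_heavy_values (T I : finType) (Q : pred T) (f : T -> I) h :
  #|[pred z | #|[pred x | Q x]| < 2 ^ h * #|[pred x | Q x && (f x == z)]|]| <= 2 ^ h.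
Proof.
set c := #|[pred x | Q x]|; set Hz := [pred z | _].
have sumE : \sum_z #|[pred x | Q x && (f x == z)]| = c.
  rewrite /c -sum1_card (partition_big f predT) //=.
  by apply: eq_bigr => z _; rewrite sum1_card.
have le : #|Hz| * c <= 2 ^ h * c.
  rewrite -sum_nat_const -{2}sumE big_distrr /= [X in _ <= X](bigID (mem Hz)) /=.
  by apply: leq_trans (leq_addr _ _); apply: leq_sum => z; rewrite inE => /ltnW.
have [c0|c0] := posnP c; last by rewrite leq_pmul2r in le.
rewrite eq_card0 // => z; rewrite !inE; apply/negbTE; rewrite -leqNgt c0.
rewrite leqn0 muln_eq0; apply/orP; right; rewrite -leqn0 -[X in _ <= X]c0.
by apply/subset_leq_card/subsetP => x; rewrite !inE => /andP[].
Qed.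

(* One step of the induction: [l], [A], [r] are the inputs to the left of, at and to
   the right of a player, [u] and [v] the transcripts of its left and right links
   at the start of the step, [v2] that of its right link at the end. *)
Section Step.
Variables (n : nat) (L R U V V2 : finType).
Local Notation MT := ('M['F_2]_n).
Local Notation VT := ('cV['F_2]_n).
Variables (y : L -> VT) (u : L -> MT -> R -> U) (v : L -> MT -> R -> V).
Variables (v2 : L -> MT -> R -> V2) (tr : V2 -> V).
Variables (X : U -> pred L) (S : U -> V -> R -> pred MT) (hv2 : V2 -> pred VT).
(** Exponents: [a] for light values, [b] for the error, [g] for the new bits on the right link, [h]
    for heavy images, [t] for both transcripts; [q] counts independent vectors. *)
Variables (a b g h q t : nat).

Hypothesis trE : forall l A r, tr (v2 l A r) = v l A r.
Hypothesis rectangle : forall p p' l A r,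
  (u l A r == p) && (v l A r == p') = X p l && S p p' r A.
Hypothesis tr_few : forall p', #|[pred p2 | tr p2 == p']| <= 2 ^ g.
Hypothesis hv2_few : forall p2, #|[pred z | hv2 p2 z]| <= 2 ^ a.
Hypothesis UV_few : #|U| * #|V| <= 2 ^ t.
Hypothesis qba : q + b < a.
Hypothesis hE : h = a + g + b.
Hypothesis tq : t + b + (h + b.+1) * q <= n * q.

Definition light p z := 2 ^ a * #|[pred l | X p l && (y l == z)]| <= #|[pred l | X p l]|.

Definition heavy p p' r (z z' : VT) :=
  #|[pred A | S p p' r A]| < 2 ^ h * #|[pred A | S p p' r A && (A *m z == z')%R]|.

(** For fixed [r], the inputs with given transcripts form a product, so [l] and [A] vary
    independently. *)
Lemma sum_rectangle (F : U -> V -> R -> L -> MT -> nat) :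
  \sum_l \sum_A \sum_r F (u l A r) (v l A r) r l A =
  \sum_r \sum_p \sum_p' \sum_(l | X p l) \sum_(A | S p p' r A) F p p' r l A.
Proof.
under eq_bigr do rewrite exchange_big /=.
rewrite exchange_big /=; apply: eq_bigr => r _.
rewrite pair_big /=.
rewrite (partition_big (fun i => u i.1 i.2 r) predT) //=; apply: eq_bigr => p _.
rewrite (partition_big (fun i => v i.1 i.2 r) predT) //=; apply: eq_bigr => p' _.
rewrite pair_big_dep /=.
by apply: eq_big => [i|i /andP[/eqP -> /eqP ->]].
Qed.

(** In each rectangle [card_bad_mx] applies to the law of [y l], cut down to light values. Matrices
    that are not bad contribute at most a [2^-b] share of the rectangle; by [tq] the bad ones are at
    most a [2^-(t+b)] share of all matrices, affordable for each of the [2^t] transcript pairs. *)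
Lemma sum_heavy :
  2 ^ b * (\sum_l \sum_A \sum_r (light (u l A r) (y l) &&
     heavy (u l A r) (v l A r) r (y l) (A *m y l)%R))
  <= 2 * (#|L| * #|{: MT}| * #|R|).
Proof.
rewrite (sum_rectangle (fun p p' r l A =>
  (light p (y l) && heavy p p' r (y l) (A *m y l)%R : bool))).
have block r p p' :
  2 ^ b * (\sum_(l | X p l) \sum_(A | S p p' r A)
     (light p (y l) && heavy p p' r (y l) (A *m y l)%R))
   * 2 ^ t <= (\sum_(l | X p l) \sum_(A | S p p' r A) 1) * 2 ^ t
     + #|L| * #|{: MT}|.
  set M := #|[pred l | X p l]|.
  pose w z := if light p z then #|[pred l | X p l && (y l == z)]| else 0.
  have [M0|M0] := posnP M.
    by rewrite big_pred0 ?muln0 // => l; have := card0_eq M0 l; rewrite inE.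
  have w_small z : w z * 2 ^ a <= M.
    by rewrite /w; case: ifP => // ; rewrite /light mulnC.
  have w_sum : \sum_z w z <= M.
    have -> : M = \sum_z #|[pred l | X p l && (y l == z)]|.
      rewrite /M -sum1_card (partition_big y predT) //=.
      by apply: eq_bigr => z _; rewrite sum1_card.
    by apply: leq_sum => z _; rewrite /w; case: ifP.
  have Hv_few z : #|[pred z' | heavy p p' r z z']| <= 2 ^ h.
    exact: card_heavy_values.
  have bad := card_bad_mx w_small w_sum Hv_few M0 qba.
  set Bad := bad_mx w M (heavy p p' r) b in bad.
  have inner A : \sum_(l | X p l) (light p (y l) && heavy p p' r (y l) (A *m y l)%R)
     = \sum_(z | heavy p p' r z (A *m z)%R) w z.
    rewrite (partition_big y predT) //= [RHS]big_mkcond /=; apply: eq_bigr => z _.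
    rewrite /w; case hz: (heavy _ _ _ _ _); last first.
      by rewrite big1 // => l /andP[_ /eqP ->]; rewrite hz andbF.
    case: ifP => lz.
      by rewrite -sum1_card; apply: eq_bigr => l /andP[_ /eqP ->]; rewrite lz hz.
    by rewrite big1 // => l /andP[_ /eqP ->]; rewrite lz.
  have inner_le A : 2 ^ b * (\sum_(l | X p l) (light p (y l) && heavy p p' r (y l) (A *m y l)%R))
     <= M + 2 ^ b * M * Bad A.
    rewrite inner; case: (boolP (Bad A)) => [_|]; last by rewrite /Bad /bad_mx -leqNgt muln0 addn0.
    rewrite muln1; apply: leq_trans (leq_addl _ _); rewrite leq_mul2l; apply/orP; right.
    apply: leq_trans w_sum; rewrite [X in _ <= X](bigID (fun z => heavy p p' r z (A *m z)%R)) /=.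
    exact: leq_addr.
  rewrite exchange_big big_distrr /=.
  apply: leq_trans (leq_mul (leq_sum _ (fun A _ => inner_le A)) (leqnn _)) _.
  rewrite big_split /= mulnDl; apply: leq_add.
    rewrite leq_mul2r; apply/orP; right; rewrite exchange_big /=.
    by apply: leq_sum => A _; rewrite sum1_card.
  rewrite -big_distrr /=.
  have badc : \sum_(A | S p p' r A) Bad A <= #|[pred A | Bad A]|.
    rewrite -sum1_card [leqLHS]big_mkcond [leqRHS]big_mkcond /=.
    by apply: leq_sum => A _; case: ifP => // _; rewrite inE; case: (Bad A).
  apply: (@leq_trans (2 ^ b * M * #|[pred A | Bad A]| * 2 ^ t)).
    by rewrite leq_mul2r leq_mul2l badc !orbT.
  have ML : M <= #|L| by apply: max_card.
  apply: (@leq_trans (M * #|{: MT}|)); last by rewrite leq_mul2r ML orbT.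
  have -> : 2 ^ b * M * #|[pred A | Bad A]| * 2 ^ t = M * (#|[pred A | Bad A]| * 2 ^ (t + b)).
    by rewrite expnD; lia.
  rewrite leq_mul2l; apply/orP; right.
  rewrite -(@leq_pmul2r (2 ^ ((h + b.+1) * q))) ?expn_gt0 // card_F2_mx.
  apply: leq_trans bad; rewrite -mulnA -expnD leq_mul2l leq_exp2l // tq orbT //.
rewrite -(@leq_pmul2r (2 ^ t)) ?expn_gt0 // !big_distrr /= big_distrl /=.
apply: (@leq_trans (\sum_r \sum_p \sum_p'
   ((\sum_(l | X p l) \sum_(A | S p p' r A) 1) * 2 ^ t + #|L| * #|{: MT}|))).
  apply: leq_sum => r _; rewrite big_distrr /= big_distrl /=; apply: leq_sum => p _.
  rewrite big_distrr /= big_distrl /=; apply: leq_sum => p' _; exact: block.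
under eq_bigr do under eq_bigr do rewrite big_split /= -big_distrl /=.
under eq_bigr do rewrite big_split /= -big_distrl /=.
rewrite big_split /= -big_distrl /= -(sum_rectangle (fun _ _ _ _ _ => 1)).
rewrite !sum_nat_const muln1.
rewrite -mulnA mul2n -addnn mulnDl leq_add //.
  by rewrite !mulnA leqnn.
have -> : #|R| * (#|U| * (#|V| * (#|L| * #|{: MT}|))) =
  #|L| * #|{: MT}| * #|R| * (#|U| * #|V|) by lia.
by rewrite leq_mul2l UV_few orbT.
Qed.

(** For each [l] in each rectangle, either [z] is heavy for [y l] and nothing is counted, or at most
    a [2^-h] share of the matrices sends [y l] to [z]. *)
Lemma sum_not_heavy_fiber p' z :
  2 ^ h * (\sum_l \sum_A \sum_r (~~ heavy (u l A r) (v l A r) r (y l) (A *m y l)%R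
      && (v l A r == p') && (A *m y l == z)%R))
  <= \sum_l \sum_A \sum_r (v l A r == p').
Proof.
rewrite (sum_rectangle (fun p p1 r l A =>
  (~~ heavy p p1 r (y l) (A *m y l)%R && (p1 == p') && (A *m y l == z)%R : bool))).
rewrite (sum_rectangle (fun p p1 r l A => (p1 == p' : bool))).
rewrite big_distrr /=; apply: leq_sum => r _; rewrite big_distrr /=; apply: leq_sum => p _.
rewrite big_distrr /=; apply: leq_sum => p1 _; rewrite big_distrr /=; apply: leq_sum => l _.
case: (p1 =P p') => [->|_]; last by rewrite big1 ?muln0 // => A _; rewrite andbF.
set c := \sum_(_ | _) _; rewrite sum1_card.
case: (boolP (heavy p p' r (y l) z)) => [hz|].
  rewrite /c big1 ?muln0 // => A _; case: (_ =P z) => [->|]; last by rewrite andbF.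
  by rewrite hz.
rewrite /heavy -leqNgt; apply: leq_trans; rewrite leq_mul2l; apply/orP; right.
rewrite /c -sum1_card [leqLHS]big_mkcond [leqRHS]big_mkcond /=; apply: leq_sum => A _.
rewrite !inE; case: (S _ _ _ A) => //=.
by case: (_ == z); rewrite ?andbF //; case: (_ && _).
Qed.

(** Heavy images cost the [2] of [sum_heavy]. For the others, a union bound over [p2] and the [2^a]
    values of [hv2 p2] costs [2^(a+g-h) = 2^-b]. *)
Lemma step_count :
  2 ^ b * (\sum_l \sum_A \sum_r (light (u l A r) (y l) && hv2 (v2 l A r) (A *m y l)%R))
  <= 3 * (#|L| * #|{: MT}| * #|R|).
Proof.
set tot := #|L| * _ * _.
pose hvy l A r := heavy (u l A r) (v l A r) r (y l) (A *m y l)%R.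
have part : 2 ^ b * (\sum_l \sum_A \sum_r (~~ hvy l A r && hv2 (v2 l A r) (A *m y l)%R)) <= tot.
  rewrite -(@leq_pmul2l (2 ^ (a + g))) ?expn_gt0 // mulnA -expnD -hE.
  have -> : \sum_l \sum_A \sum_r (~~ hvy l A r && hv2 (v2 l A r) (A *m y l)%R : nat) =
     \sum_p2 \sum_(z | hv2 p2 z) \sum_l \sum_A \sum_r 
        (~~ hvy l A r && (v2 l A r == p2) && (A *m y l == z)%R).
    under [RHS]eq_bigr do rewrite big_mkcond.
    have E l A r : (~~ hvy l A r && hv2 (v2 l A r) (A *m y l)%R : nat) =
      \sum_p2 \sum_z if hv2 p2 z then (~~ hvy l A r && (v2 l A r == p2) && (A *m y l == z)%R : nat) else 0.
      rewrite (bigD1 (v2 l A r)) //= [X in _ = _ + X]big1 ?addn0; last first.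
        move=> p2 /negbTE; rewrite eq_sym => ne; apply: big1 => z _.
        by rewrite ne andbF; case: ifP.
      rewrite (bigD1 (A *m y l)%R) //= big1 ?addn0; last first.
        move=> z /negbTE; rewrite eq_sym => ne.
        by rewrite ne andbF; case: ifP.
      by rewrite !eqxx !andbT; case: (hv2 _ _); rewrite ?andbT ?andbF.
    under eq_bigr do under eq_bigr do under eq_bigr do rewrite E.
    under eq_bigr do under eq_bigr do (rewrite exchange_big /=; under eq_bigr do rewrite exchange_big /=).
    under eq_bigr do (rewrite exchange_big /=; under eq_bigr do rewrite exchange_big /=).
    rewrite exchange_big /=; apply: eq_bigr => p2 _.
    rewrite exchange_big /=; apply: eq_bigr => z _.
    case: ifP => // _.
    by rewrite big1 // => l _; rewrite big1 // => A _; rewrite big1.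
  (* The rectangles control [v] but not [v2], so [v2 = p2] is weakened to [v = tr p2]; each value of
     [v] is then counted for at most [2^g] extensions. *)
  apply: (@leq_trans (\sum_p2 2 ^ a * \sum_l \sum_A \sum_r (v l A r == tr p2))).
    rewrite big_distrr /=; apply: leq_sum => p2 _.
    rewrite big_distrr /=.
    apply: (@leq_trans (\sum_(z | hv2 p2 z) \sum_l \sum_A \sum_r (v l A r == tr p2))).
      apply: leq_sum => z _; apply: leq_trans (sum_not_heavy_fiber (tr p2) z).
      rewrite leq_mul2l; apply/orP; right.
      apply: leq_sum => l _; apply: leq_sum => A _; apply: leq_sum => r _.
      case: (v2 l A r =P p2) => [<-|_]; last by rewrite andbF.
      by rewrite trE eqxx -/(hvy l A r).
    rewrite sum_nat_const leq_mul2r; apply/orP; right; exact: hv2_few.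
  rewrite -big_distrr /= expnD -mulnA leq_mul2l; apply/orP; right.
  rewrite exchange_big /=.
  under eq_bigr do (rewrite exchange_big /=; under eq_bigr do rewrite exchange_big /=).
  apply: (@leq_trans (\sum_(l : L) \sum_(A : MT) \sum_(r : R) 2 ^ g)).
    apply: leq_sum => l _; apply: leq_sum => A _; apply: leq_sum => r _.
    apply: leq_trans (tr_few (v l A r)).
    rewrite -sum1_card [X in _ <= X]big_mkcond /=; apply: leq_sum => p2 _.
    by rewrite inE eq_sym; case: (_ == _).
  by rewrite !sum_nat_const [leqRHS]mulnC /tot !mulnA.
have := leq_add sum_heavy part; rewrite -/tot -mulnDr -mulSnr => le.
apply: leq_trans le; rewrite leq_mul2l; apply/orP; right.
rewrite -big_split; apply: leq_sum => l _; rewrite -big_split; apply: leq_sum => A _.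
rewrite -big_split; apply: leq_sum => r _ /=; rewrite -/(hvy l A r).
by case: (light _ _) (hvy l A r) (hv2 _ _) => [] [] [].
Qed.

End Step.

(** * Splicing left and right inputs *)

Section Splice.
Variables (N k : nat).
Local Notation Omega := ('cV['F_2]_N * {ffun 'I_k -> 'M['F_2]_N})%type.
Implicit Types l r w : Omega.

(** [A] takes index [j], the matrix held by [P_{j+1}]; for [j = k] this is out of range and the
    result is [l]. *)
Definition splice j l (A : 'M['F_2]_N) r : Omega :=
  (l.1, [ffun i : 'I_k => if i < j then l.2 i else if i == j :> nat then A else r.2 i]).

Definition partial_product j w : 'cV['F_2]_N :=
  foldl (fun v i => (getA w.2 i *m v)%R) w.1 (iota 0 j).

Lemma partial_productS j w :
  partial_product j.+1 w = (getA w.2 j *m partial_product j w)%R.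
Proof. by rewrite /partial_product -[j.+1]addn1 iotaD foldl_cat. Qed.

Lemma getA_splice_lt j l A r i : i < j -> getA (splice j l A r).2 i = getA l.2 i.
Proof. by rewrite /getA; case: insubP => //= o _ <- ij; rewrite ffunE ij. Qed.

Lemma getA_splice_eq j l A r : j < k -> getA (splice j l A r).2 j = A.
Proof. by rewrite /getA => jk; rewrite insubT /= ffunE /= ltnn eqxx. Qed.

Lemma getA_splice_ge j l l' A r i : j <= i ->
  getA (splice j l A r).2 i = getA (splice j l' A r).2 i.
Proof.
by rewrite /getA; case: insubP => //= o _ <- ji; rewrite !ffunE ltnNge ji.
Qed.

Lemma partial_product_splice i j l A r : i <= j ->
  partial_product i (splice j l A r) = partial_product i l.
Proof.
elim: i => // i IH ij; rewrite !partial_productS IH ?(ltnW ij) //.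
by rewrite getA_splice_lt.
Qed.

Lemma splice_last l A r : splice k l A r = l.
Proof. by rewrite /splice; case: l => x As /=; congr pair; apply/ffunP => i; rewrite ffunE ltn_ord. Qed.

(* [(l, A, r) |-> (splice j l A r, A_j of l, the unused part of r and l)] is an
   involution, so a spliced input is uniform when its pieces are. *)
Lemma sum_splice j (F : Omega -> nat) : j < k ->
  \sum_l \sum_A \sum_r F (splice j l A r) = #|{: 'M['F_2]_N}| * #|{: Omega}| * \sum_w F w.
Proof.
move=> jk; pose o := Ordinal jk.
pose f (p : Omega * ('M['F_2]_N * Omega)) :=
  (splice j p.1 p.2.1 p.2.2, (p.1.2 o, splice j p.2.2 (p.2.2.2 o) p.1)).
have fK : involutive f.
  move=> [[x As] [A [x' Bs]]]; rewrite /f /splice /=; congr (_, _, (_, (_, _))).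
  - apply/ffunP => i; rewrite !ffunE; case: ltngtP => //= ij; last first.
      by congr (As _); apply: val_inj.
  - by rewrite ffunE /= ltnn eqxx.
  - apply/ffunP => i; rewrite !ffunE /= ?ltnn ?eqxx; case: ltngtP => //= ij.
      by congr (Bs _); apply: val_inj.
under eq_bigr do rewrite pair_big /=.
rewrite pair_big /= (reindex_inj (inv_inj fK)) /=.
transitivity (\sum_(p : Omega * ('M['F_2]_N * Omega)) F p.1).
  by apply: eq_bigr => p _; have := congr1 fst (fK p) => /= ->.
rewrite -(pair_big predT predT (fun w (_ : 'M['F_2]_N * Omega) => F w)) /=.
under eq_bigr do rewrite sum_nat_const.
by rewrite -big_distrr /= card_prod.
Qed.

End Splice.

(** * Induction along the line for fixed randomness *)

Section Protocol.
Variables (N k m : nat) (P : protocol N k m) (rho : {ffun 'I_k.+2 -> m.-tuple bool}).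
Local Notation Omega := ('cV['F_2]_N * {ffun 'I_k -> 'M['F_2]_N})%type.
Local Notation run w := (run P rho (local_input w.1 w.2)).

Lemma local_input_splice_le j (l r : Omega) A p : p <= j ->
  local_input (splice j l A r).1 (splice j l A r).2 p = local_input l.1 l.2 p.
Proof.
rewrite /local_input; case: p => //= p pj; case: ifP => // _.
by rewrite getA_splice_lt.
Qed.

Lemma local_input_splice_gt j (l l' r : Omega) A p : j < p ->
  local_input (splice j l A r).1 (splice j l A r).2 p =
  local_input (splice j l' A r).1 (splice j l' A r).2 p.
Proof.
rewrite /local_input; case: p => //= p pj; case: ifP => // _.
by rewrite (@getA_splice_ge _ _ _ l l').
Qed.

(** A tuple, so that transcripts range over a finite type; the default [false] is never read for
    [j <= k]. *)
Definition link t j (w : Omega) : t.-tuple bool := [tuple nth false (run w t j) i | i < t].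

Lemma linkE t j w : j <= k -> link t j w = run w t j :> seq bool.
Proof.
move=> jk; apply: (@eq_from_nth _ false); rewrite ?size_tuple ?size_run // => i it.
by rewrite -[i]/(val (Ordinal it)) -tnth_nth tnth_mktuple.
Qed.

Lemma link_inj t j w w' : j <= k -> (link t j w = link t j w') <-> (run w t j = run w' t j).
Proof.
move=> jk; split=> [E|E]; first by rewrite -!linkE // E.
by apply: val_inj; rewrite /= !linkE.
Qed.

(* To avoid dependent types, left and right inputs are whole inputs whose
   irrelevant half is ignored; this multiplies all counts by the same factor. *)
Definition left_consistent t j (p : t.-tuple bool) (l : Omega) :=
  [exists A, exists r, link t j (splice j l A r) == p].

(** Cut and paste at link [j]: a run with left input [l] and one with right part [A], [r] combine if
    both show [p] there. Quantifying over [l'] frees the second condition from [l]. *)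
Lemma link_rectangle t j (p p' : t.-tuple bool) l A r : j < k ->
  (link t j (splice j l A r) == p) && (link t j.+1 (splice j l A r) == p') =
  left_consistent j p l &&
  [exists l', (link t j (splice j l' A r) == p) && (link t j.+1 (splice j l' A r) == p')].
Proof.
move=> jk; have jk' := ltnW jk; apply/idP/idP => [H|].
  apply/andP; split; last by apply/existsP; exists l.
  by case/andP: H => H _; apply/existsP; exists A; apply/existsP; exists r.
case/andP=> /existsP[A1 /existsP[r1 /eqP E1]] /existsP[l2 /andP[/eqP E2 /eqP E3]].
have [] := @run_mix _ _ _ P rho (local_input (splice j l A r).1 (splice j l A r).2)
  (local_input (splice j l A1 r1).1 (splice j l A1 r1).2)
  (local_input (splice j l2 A r).1 (splice j l2 A r).2) j t _ _ _ j.+1.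
- by move=> q qj; rewrite !local_input_splice_le.
- by move=> q qj; apply: local_input_splice_gt.
- by apply/(link_inj t (splice j l A1 r1) (splice j l2 A r) jk'); rewrite E1 E2.
move=> _ /(_ (leqnSn j)) R3.
have [] := @run_mix _ _ _ P rho (local_input (splice j l A r).1 (splice j l A r).2)
  (local_input (splice j l A1 r1).1 (splice j l A1 r1).2)
  (local_input (splice j l2 A r).1 (splice j l2 A r).2) j t _ _ _ j.
- by move=> q qj; rewrite !local_input_splice_le.
- by move=> q qj; apply: local_input_splice_gt.
- by apply/(link_inj t (splice j l A1 r1) (splice j l2 A r) jk'); rewrite E1 E2.
move=> /(_ (leqnn j)) R1 _.
apply/andP; split; apply/eqP.
  by rewrite -E1; apply/(link_inj t (splice j l A r) (splice j l A1 r1) jk').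
by rewrite -E3; apply/(link_inj t (splice j l A r) (splice j l2 A r) jk).
Qed.

Variable e : nat.
Hypothesis eN : 32 * e <= N.
Hypothesis N9 : 9 <= N.
Hypothesis kN : k <= N.

(** The invariant of the induction. The exponent [5 e + 1] just exceeds [q + b] for [q = 4 e] and
    [b = e]. *)
Definition lit j w :=
  light (partial_product j) (left_consistent (t := j * e) j) (5 * e).+1
    (link (j * e) j w) (partial_product j w).

Definition prefix_tuple s t (p : t.-tuple bool) : s.-tuple bool := [tuple nth false p i | i < s].

Lemma prefix_link s t j w : j <= k -> prefix_tuple s (link (s + t) j w) = link s j w.
Proof.
move=> jk; apply: eq_from_tnth => i; rewrite !tnth_mktuple linkE //.
by rewrite -(take_run P rho _ s t jk) nth_take.
Qed.

Lemma card_prefix s t (p : s.-tuple bool) :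
  #|[pred p2 : (s + t).-tuple bool | prefix_tuple s p2 == p]| <= 2 ^ t.
Proof.
pose f (p2 : (s + t).-tuple bool) : t.-tuple bool := [tuple nth false p2 (s + i) | i < t].
rewrite -card_bool -card_tuple -(card_in_image (f := f)); first exact: max_card.
move=> p1 p2; rewrite !inE => /eqP E1 /eqP E2 E.
apply: val_inj; apply: (@eq_from_nth _ false); rewrite ?size_tuple // => i it.
have [si|si] := ltnP i s.
  have := congr1 (fun q : s.-tuple bool => tnth q (Ordinal si)) (etrans E1 (esym E2)).
  by rewrite /= !tnth_mktuple.
have ti : i - s < t by lia.
have := congr1 (fun q : t.-tuple bool => tnth q (Ordinal ti)) E.
by rewrite /= !tnth_mktuple /= subnKC.
Qed.

Lemma lit_step j : j < k ->
  2 ^ e * (\sum_w (lit j w && ~~ lit j.+1 w)) <= 3 * #|{: Omega}|.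
Proof.
move=> jk.
have M0 : 0 < #|{: 'M['F_2]_N}| * #|{: Omega}|.
  by rewrite muln_gt0; apply/andP; split; apply/card_gt0P; [exists 0%R | exists (0%R, [ffun=> 0%R])].
rewrite -(@leq_pmul2l (#|{: 'M['F_2]_N}| * #|{: Omega}|)) // mulnCA -(sum_splice (fun w => (lit j w && ~~ lit j.+1 w : nat)) jk).
have E l A r : (lit j (splice j l A r) && ~~ lit j.+1 (splice j l A r) : nat) =
  (light (partial_product j) (left_consistent (t := j * e) j) (5 * e).+1
     (link (j * e) j (splice j l A r)) (partial_product j l) &&
   ~~ light (partial_product j.+1) (left_consistent (t := j * e + e) j.+1) (5 * e).+1
     (link (j * e + e) j.+1 (splice j l A r)) (A *m partial_product j l)%R).
  rewrite /lit partial_productS getA_splice_eq // !partial_product_splice //.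
  by rewrite -[j.+1 * e]/(e + j * e) addnC.
under eq_bigr do under eq_bigr do under eq_bigr do rewrite E.
(* The right link is read at time [j e] and again [e] rounds later, so [g = e]. For [q = 4 e] and
   [t = 2 j e], hypothesis [tq] follows from [32 e <= N], [j < k <= N] and [9 <= N]. *)
have := @step_count N Omega Omega _ _ _ (partial_product j)
  (fun l A r => link (j * e) j (splice j l A r))
  (fun l A r => link (j * e) j.+1 (splice j l A r))
  (fun l A r => link (j * e + e) j.+1 (splice j l A r))
  (@prefix_tuple (j * e) (j * e + e)) (left_consistent (t := j * e) j)
  (fun p p' r A => [exists l', (link (j * e) j (splice j l' A r) == p)
                       && (link (j * e) j.+1 (splice j l' A r) == p')])
  (fun p2 z => ~~ light (partial_product j.+1) (left_consistent (t := j * e + e) j.+1) (5 * e).+1 p2 z)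
  (5 * e).+1 e e (7 * e).+1 (4 * e) (2 * (j * e)).
move=> H; apply: leq_trans (H _ _ _ _ _ _ _ _) _.
- by move=> l A r; rewrite prefix_link.
- by move=> p p' l A r; apply: link_rectangle.
- by move=> p'; apply: card_prefix.
- move=> p2.
  apply: leq_trans (@card_heavy_values Omega _ (left_consistent j.+1 p2) (partial_product j.+1) _).
  by apply/subset_leq_card/subsetP => z; rewrite !inE /light -ltnNge.
- by rewrite !card_tuple card_bool -expnD mul2n -addnn.
- lia.
- lia.
- nia.
- by rewrite [#|{: Omega}| * _]mulnC mulnCA.
Qed.

(** Before any round every input is consistent, and [y_0 = x] is uniform on [2^N] vectors with
    [5 e + 1 <= N]. *)
Lemma lit0 w : lit 0 w.
Proof.
have all p l : left_consistent (t := 0 * e) 0 p l.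
  by apply/existsP; exists 0%R; apply/existsP; exists w; apply/eqP/eq_from_tnth => -[].
rewrite /lit /light.
apply: (@leq_trans (2 ^ N * #|{: {ffun 'I_k -> 'M['F_2]_N}}|)).
  apply: leq_mul; first by rewrite leq_exp2l //; lia.
  apply: (@leq_trans #|[predX (pred1 w.1) & {ffun 'I_k -> 'M['F_2]_N}]|).
    apply/subset_leq_card/subsetP => l; rewrite !inE => /andP[_ /eqP El].
    by rewrite -[w.1]El eqxx.
  by rewrite cardX card1 mul1n.
rewrite -[2 ^ N](_ : #|{: 'cV['F_2]_N}| = _); last by rewrite card_F2_mx muln1.
by rewrite -card_prod; apply/subset_leq_card/subsetP => l _; rewrite inE all.
Qed.

Lemma card_not_lit j : j <= k -> 2 ^ e * (\sum_w ~~ lit j w) <= 3 * j * #|{: Omega}|.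
Proof.
elim: j => [|j IH] jk; first by rewrite big1 ?muln0 // => w _; rewrite lit0.
apply: (@leq_trans (2 ^ e * (\sum_w ~~ lit j w) + 2 ^ e * (\sum_w (lit j w && ~~ lit j.+1 w)))).
  rewrite -mulnDr leq_mul2l -big_split; apply/orP; right; apply: leq_sum => w _ /=.
  by case: (lit j w) (lit j.+1 w) => [] [].
by rewrite mulnSr mulnDl leq_add ?IH ?lit_step // ltnW.
Qed.

(** The output is a function of the last transcript [p]. If it is light given [p], it is correct on
    at most a [2^-(5e+1)] share of the inputs with that transcript; if not, it is correct on no
    [lit] input. *)
Lemma card_correct_lit T : T <= k * e ->
  2 ^ e * (\sum_(w : Omega) (lit k w && correct_run P T w.1 w.2 rho)) <= #|{: Omega}|.
Proof.
move=> Tk; pose o (p : (k * e).-tuple bool) := out P (rho ord_max) (take T p).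
have E w : correct_run P T w.1 w.2 rho = (o (link (k * e) k w) == partial_product k w).
  rewrite /correct_run /o linkE // transcripts_run.
  by rewrite -(take_run P rho _ T (k * e - T)) // subnKC.
(* No matrix lies to the right of link [k], so splicing there changes nothing. *)
have LC p : left_consistent (t := k * e) k p =1 (fun l => link (k * e) k l == p).
  move=> l; apply/existsP/idP => [[A /existsP[r]]|H]; first by rewrite splice_last.
  by exists 0%R; apply/existsP; exists l; rewrite splice_last.
have -> : #|{: Omega}| = \sum_p #|[pred l | left_consistent (t := k * e) k p l]|.
  rewrite -sum1_card (partition_big (link (k * e) k) predT) //=.
  by apply: eq_bigr => p _; rewrite -sum1_card; apply: eq_bigl => l; rewrite inE LC.
rewrite (partition_big (link (k * e) k) predT) //= big_distrr /=; apply: leq_sum => p _.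
case: (boolP (light (partial_product k) (left_consistent (t := k * e) k) (5 * e).+1 p (o p))) => [li|nli].
  apply: leq_trans li; apply: leq_mul; first by rewrite leq_exp2l //; lia.
  rewrite -sum1_card [leqLHS]big_mkcond [leqRHS]big_mkcond /=; apply: leq_sum => w _.
  rewrite inE LC E; case: (_ =P p) => //= ->; rewrite eq_sym.
  by case: (_ == _); rewrite ?andbF //; case: (lit k w).
rewrite big1 ?muln0 // => w /eqP Ew; rewrite E /lit Ew.
by case: (o p =P _) => [<-|]; rewrite ?andbF // (negbTE nli).
Qed.

Lemma card_correct T : T <= k * e ->
  2 ^ e * #|[pred w : Omega | correct_run P T w.1 w.2 rho]| <= (3 * k).+1 * #|{: Omega}|.
Proof.
move=> Tk; rewrite mulSnr.
apply: leq_trans (leq_add (card_not_lit (leqnn k)) (card_correct_lit Tk)).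
rewrite -mulnDr leq_mul2l -big_split -sum1_card big_mkcond /=; apply/orP; right.
by apply: leq_sum => w _; rewrite inE; case: (correct_run _ _ _ _ _); case: (lit k w).
Qed.

End Protocol.

(** * Randomized protocols and the choice of constants *)

Lemma succeeds_half_rounds N k m (P : protocol N k m) T e :
  32 * e <= N -> 9 <= N -> k <= N -> 6 * k + 2 < 2 ^ e ->
  succeeds_half P T -> k * e < T.
Proof.
move=> eN N9 kN ke; rewrite ltnNge /succeeds_half => half; apply/negP => Tk.
set Omega := ('cV['F_2]_N * {ffun 'I_k -> 'M['F_2]_N})%type in half.
set Rho := ({ffun 'I_k.+2 -> m.-tuple bool}) in half.
set good := (X in 2 * X) in half.
have goodE : good = \sum_(rho : Rho) #|[pred w : Omega | correct_run P T w.1 w.2 rho]|.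
  rewrite /good -sum1_card.
  rewrite (eq_bigl (fun p : Omega * Rho => true && correct_run P T p.1.1 p.1.2 p.2)) //.
  rewrite -(pair_big_dep predT (fun w rho => correct_run P T w.1 w.2 rho) (fun _ _ => 1)) /=.
  rewrite (exchange_big_dep predT) //=.
  by apply: eq_bigr => rho _; rewrite sum1_card.
(* The bound for each fixed [rho] is averaged; success one half would then force
   [2^e <= 6 k + 2]. *)
have up : 2 ^ e * good <= (3 * k).+1 * #|{: Omega * Rho}|.
  rewrite goodE big_distrr card_prod mulnA [leqRHS]mulnC -sum_nat_const /=.
  by apply: leq_sum => rho _; apply: card_correct.
have pos : 0 < #|{: Omega * Rho}|.
  by apply/card_gt0P; exists (0%R, [ffun=> 0%R], [ffun=> [tuple of nseq m false]]).
have : 2 ^ e * #|{: Omega * Rho}| <= (6 * k + 2) * #|{: Omega * Rho}|.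
  apply: (@leq_trans (2 ^ e * (2 * good))); first by rewrite leq_mul2l half orbT.
  rewrite mulnCA; apply: leq_trans (leq_mul (leqnn 2) up) _.
  by rewrite mulnA leq_mul2r; apply/orP; right; lia.
by rewrite leq_pmul2r // leqNgt ke.
Qed.

Theorem theorem6p4 :
  exists c : rat, (0 < c)%R /\
  exists N0 : nat, forall N : nat, (N0 <= N)%N ->
  forall k : nat, (1 <= k <= N)%N ->
  forall (m : nat) (P : protocol N k m) (T : nat),
    succeeds_half P T -> (c * (k * N)%:R <= T%:R)%R.
Proof.
(* The constant comes from [N < 32 e + 32 <= 64 e]. *)
exists (64%:R^-1)%R; split; first by rewrite invr_gt0 ltr0n.
(* [384 = 32 * 12] ensures [e >= 12], from where on [6 k + 2 <= 6 N + 2 < 192 e + 194 < 2^e]. *)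
exists 384 => N NN k /andP[k0 kN] m P T half.
pose e := N %/ 32.
have e12 : 12 <= e by rewrite /e; lia.
have eN : 32 * e <= N < 32 * e + 32 by rewrite /e; lia.
have large : 192 * e + 194 < 2 ^ e.
  rewrite -(subnK e12); elim: (e - 12) => [|i IH]; first by [].
  by rewrite addSn expnS; lia.
have Te : k * e < T by apply: succeeds_half_rounds half; lia.
rewrite mulrC ler_pdivrMr ?ltr0n // -natrM ler_nat; nia.
Qed.
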